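(* Let $n$ be a positive integer and let $G$ be an $H_4$-free bipartite graph with $n$ vertices in each part. Then $\tilde h(G)\ge \lfloor 2n/5\rfloor$. This bound is tight for $n\equiv 0\pmod 5$, i.e., for every positive integer $n$ divisible by $5$ there is an $H_4$-free bipartite graph $G$ with $n$ vertices in each part and $\tilde h(G)=2n/5$.
   Context: All graphs are finite. A bipartite graph $G=((U,V),E)$ comes with a fixed ordered pair of parts (top part $U$, bottom part $V$) and $E\subseteq U\times V$. $\tilde\omega(G)$ is the largest integer $t$ such that there are $A\subseteq U$, $B\subseteq V$ with $|A|=|B|=t$ and $ab\in E$ for all $a\in A,b\in B$; $\tilde\alpha(G)$ is the largest integer $t$ such that there are $A\subseteq U$, $B\subseteq V$ with $|A|=|B|=t$ and $ab\notin E$ for all $a\in A$, $b\in B$; $\tilde h(G)=\max\{\tilde\alpha(G),\tilde\omega(G)\}$. A copy of $H=((X,Y),E_H)$ in $G$ is an induced copy respecting sides: injections $\phi:X\to U$ and $\psi:Y\to V$ with $xy\in E_H$ if and only if $\phi(x)\psi(y)\in E$, for all $x\in X$, $y\in Y$. $G$ is $H$-free if it contains no copy of $H$. $H_4$ is the bipartite graph with two vertices in each part and exactly two edges, which share a vertex; the shared vertex lies in the top part. That is, $H_4$ has top part $\{x_1,x_2\}$, bottom part $\{y_1,y_2\}$ and edges $x_1y_1,x_1y_2$. *)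

(* Defs.v *)
From mathcomp Require Import all_boot.

Set Implicit Arguments.
Unset Strict Implicit.
Unset Printing Implicit Defensive.

Record bigraph := Bigraph {
  top : finType;
  bot : finType;
  adj : top -> bot -> bool
}.

Definition complete_pair (G : bigraph) (A : {set top G}) (B : {set bot G}) :
    bool :=
  [forall a in A, forall b in B, adj a b].

Definition empty_pair (G : bigraph) (A : {set top G}) (B : {set bot G}) :
    bool :=
  [forall a in A, forall b in B, ~~ adj a b].

(* The maxima below range over a nonempty family, since (set0, set0) always
   qualifies; the default value 0 of \max is therefore never spurious. *)
Definition bi_omega (G : bigraph) : nat :=
  \max_(P : {set top G} * {set bot G}
        | (#|P.1| == #|P.2|) && complete_pair P.1 P.2) #|P.1|.

Definition bi_alpha (G : bigraph) : nat :=
  \max_(P : {set top G} * {set bot G}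
        | (#|P.1| == #|P.2|) && empty_pair P.1 P.2) #|P.1|.

Definition bi_h (G : bigraph) : nat := maxn (bi_alpha G) (bi_omega G).

Definition has_copy (H G : bigraph) : Prop :=
  exists (phi : top H -> top G) (psi : bot H -> bot G),
    [/\ injective phi, injective psi
      & forall x y, adj x y <-> adj (phi x) (psi y)].

Definition bifree (H G : bigraph) : Prop := ~ has_copy H G.

(* The top vertex 0 is joined to both bottom vertices, the top vertex 1 to
   neither. *)
Definition H4 : bigraph :=
  @Bigraph 'I_2 'I_2 (fun x _ => x == ord0).

(* Main.v *)
Require Import Defs.
From mathcomp Require Import all_boot.
From mathcomp Require Import zify.

Set Implicit Arguments.
Unset Strict Implicit.
Unset Printing Implicit Defensive.

(** For two top vertices u and v, an induced [H4] with top part (u, v) is a pair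
of bottom vertices adjacent to u but not to v; so [G] is [H4]-free iff
|N(u) \ N(v)| <= 1 for all u and v ([bifree_H4P]).  A family of sets with this
property is either a sunflower or a co-sunflower ([star_like_or_co]): there is
a set [C] of bottom vertices such that, in [G] or in its bipartite complement,
every N(u) is [C] with at most one further vertex.  Complementing exchanges
complete and empty pairs, so only the first alternative needs to be treated.

Put k = floor(2n/5) and let [C] be such a core.  If |C| >= k, the top part and
[C] span a complete pair.  Otherwise the complement R of [C] has more than
3n/5 vertices, and every top vertex has at most one neighbour in R, so that
the stars centred in R are disjoint.  If k vertices of R have degree at most
1, these k vertices miss at least n - k >= k top vertices.  Otherwise one can
choose k vertices of R including all those of degree at most 1; the at least
n/5 remaining vertices of R have disjoint neighbourhoods of size at least 2,
hence at least k top vertices have their only R-neighbour among them, and these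
are adjacent to none of the k chosen vertices ([star_like_leq_bi_h]).

For n = 5m the bound is attained with a core of 2m bottom vertices, the 5m top
vertices being attached in twos to vertices of the remaining 3m.  A complete
pair with more than 2m bottom vertices leaves the core and so has at most 2 top
vertices.  An empty pair with t > 0 vertices on each side avoids the core, and
its t top vertices have at least t/2 neighbours outside the core and outside
the pair; hence t + t/2 <= 3m. *)

(** * Finite sets *)

Lemma subset_of_card (T : finType) (A : {set T}) (k : nat) :
  k <= #|A| -> exists2 B : {set T}, B \subset A & #|B| = k.
Proof.
case/card_geqP=> s [s_uniq <- sA]; exists [set x in s].
  by apply/subsetP=> x; rewrite inE; exact: sA.
by rewrite cardsE; exact/card_uniqP.
Qed.

Lemma card_le1_eq (T : finType) (A : {set T}) (x y : T) :
  #|A| <= 1 -> x \in A -> y \in A -> x = y.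
Proof. by move=> /card_le1_eqP A1 xA yA; exact: A1. Qed.

Lemma card_bigcup_leq (I T : finType) (S : {set I}) (F : I -> {set T})
    (c : nat) :
  (forall i, i \in S -> #|F i| <= c) -> #|\bigcup_(i in S) F i| <= c * #|S|.
Proof.
move=> Fc; rewrite mulnC -sum_nat_const.
elim/big_rec2: _ => [|i s A iS le_s]; first by rewrite cards0.
by rewrite (leq_trans (leq_card_setU _ _).1) // leq_add ?Fc.
Qed.

(** * Bipartite graphs, their complements and homogeneous pairs *)

Definition nbr (G : bigraph) (u : top G) : {set bot G} := [set y | adj u y].

Definition conbr (G : bigraph) (y : bot G) : {set top G} := [set u | adj u y].

Definition bicompl (G : bigraph) : bigraph :=
  @Bigraph (top G) (bot G) (fun u y => ~~ adj u y).

(** [C] is a core: the neighbourhoods form a sunflower with kernel [C] and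
petals of at most one vertex, petals being allowed to coincide. *)
Definition star_like (G : bigraph) (C : {set bot G}) : Prop :=
  forall u : top G, C \subset nbr u /\ #|nbr u :\: C| <= 1.

Lemma complete_pair_leq_omega (G : bigraph) (A : {set top G})
    (B : {set bot G}) (k : nat) :
  k <= #|A| -> k <= #|B| -> (forall a b, a \in A -> b \in B -> adj a b) ->
  k <= bi_omega G.
Proof.
move=> /subset_of_card[A' /subsetP sA kA] /subset_of_card[B' /subsetP sB kB] AB.
have PAB : (#|A'| == #|B'|) && complete_pair A' B'.
  rewrite kA kB eqxx /=.
  apply/forall_inP=> a aA; apply/forall_inP=> b bB.
  by apply: AB; [exact: sA | exact: sB].
rewrite -[leqLHS]kA.
exact: (@leq_bigmax_cond _ (fun P : {set top G} * {set bot G} =>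
  (#|P.1| == #|P.2|) && complete_pair P.1 P.2) (fun P => #|P.1|) (A', B') PAB).
Qed.

Lemma bi_alpha_bicompl (G : bigraph) : bi_alpha (bicompl G) = bi_omega G.
Proof.
apply: eq_bigl => -[A B]; congr (_ && _).
by apply: eq_forallb_in => a _; apply: eq_forallb_in => b _; rewrite /= negbK.
Qed.

Lemma bi_h_bicompl (G : bigraph) : bi_h (bicompl G) = bi_h G.
Proof. by rewrite /bi_h bi_alpha_bicompl maxnC. Qed.

(** An empty pair is a complete pair of the bipartite complement. *)
Lemma empty_pair_leq_alpha (G : bigraph) (A : {set top G})
    (B : {set bot G}) (k : nat) :
  k <= #|A| -> k <= #|B| -> (forall a b, a \in A -> b \in B -> ~~ adj a b) ->
  k <= bi_alpha G.
Proof. exact: (@complete_pair_leq_omega (bicompl G)). Qed.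

(** * The structure of graphs without the forbidden pattern *)

Lemma bifree_H4P (G : bigraph) :
  bifree H4 G <-> forall u v : top G, #|nbr u :\: nbr v| <= 1.
Proof.
pose pick2 (T : Type) (s t : T) (i : 'I_2) := if i == ord0 then s else t.
have pick2_inj (T : eqType) (s t : T) : s != t -> injective (pick2 T s t).
  rewrite /pick2 => /eqP st [[|[|//]] i2] [[|[|//]] j2] //= e;
    by [apply: val_inj | case: st].
split=> [freeG u v | nbrG [phi [psi [_ psi_inj copy]]]].
  rewrite leqNgt; apply/negP=> /card_gt1P[x [y []]].
  rewrite !inE => /andP[vx ux] /andP[vy uy] xy; apply: freeG.
  have uv : u != v by apply: contraNneq vx => <-.
  exists (pick2 _ u v), (pick2 _ x y).
  split=> [||i j]; [exact: pick2_inj | exact: pick2_inj |].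
  rewrite /pick2 /=; case: (i == ord0); case: (j == ord0);
    by rewrite ?ux ?uy ?(negPf vx) ?(negPf vy).
pose i0 : 'I_2 := ord0; pose i1 : 'I_2 := ord_max.
have : 1 < #|nbr (phi i0) :\: nbr (phi i1)|.
  apply/card_gt1P; exists (psi i0), (psi i1); split.
  - rewrite !inE; apply/andP; split; last by apply/copy.
    by apply/negP=> /copy.
  - rewrite !inE; apply/andP; split; last by apply/copy.
    by apply/negP=> /copy.
  - by apply/negP=> /eqP /psi_inj.
by rewrite ltnNge nbrG.
Qed.

(** If the intersection [C] of all neighbourhoods is not a core, some N(u)
contains two vertices [x1], [x2] outside [C], missed by N(p1) and N(p2)
respectively.  Then N(u), N(p1), N(p2) force every neighbourhood to be
D = N(u) :|: N(p1) with at most one vertex deleted, and the complement of D is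
a core of the bipartite complement. *)
Lemma star_like_or_co (G : bigraph) :
  (forall u v : top G, #|nbr u :\: nbr v| <= 1) ->
  (exists C, @star_like G C) \/ (exists C, @star_like (bicompl G) C).
Proof.
move=> nbrG.
have K (u v : top G) (x y : bot G) :
    adj u x -> ~~ adj v x -> adj u y -> ~~ adj v y -> x = y.
  move=> ux vx uy vy.
  by apply: (card_le1_eq (nbrG u v)); rewrite !inE ?vx ?vy.
pose C := [set y | [forall u : top G, adj u y]].
have [starC|] := boolP [forall u : top G, #|nbr u :\: C| <= 1].
  left; exists C => u; split; last exact: (forallP starC).
  by apply/subsetP=> y; rewrite !inE => /forallP.
rewrite negb_forall => /existsP[u]; rewrite -ltnNge => /card_gt1P[x1 [x2 []]].
rewrite !inE !negb_forall => /andP[/existsP[p1 p1x1] ux1].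
case/andP=> /existsP[p2 p2x2] ux2 x12; right.
have p1x2 : adj p1 x2 by apply: contraNT x12 => p1x2; rewrite (K u p1 x1 x2).
have p2x1 : adj p2 x1 by apply: contraNT x12 => p2x1; rewrite (K u p2 x1 x2).
have p12 y : y != x1 -> y != x2 -> adj p1 y = adj p2 y.
  move=> yx1 yx2; apply/idP/idP=> py; apply: contraTT isT => npy.
    by rewrite (K p1 p2 y x2) ?eqxx in yx2.
  by rewrite (K p2 p1 y x1) ?eqxx in yx1.
exists (~: (nbr u :|: nbr p1)); rewrite /star_like /= => v; split.
  (* A neighbour y of v outside D would be the only vertex of v missed by p1,
     and likewise by p2, so v would miss both x1 and x2, against K u v. *)
  apply/subsetP=> y; rewrite !inE negb_or => /andP[uy p1y].
  apply/negP=> vy.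
  have yx1 : y != x1 by apply: contraNneq uy => ->.
  have yx2 : y != x2 by apply: contraNneq uy => ->.
  have p2y : ~~ adj p2 y by rewrite -p12.
  have vx1 : ~~ adj v x1.
    by apply: contra yx1 => vx1; apply/eqP; apply: (K v p1).
  have vx2 : ~~ adj v x2.
    by apply: contra yx2 => vx2; apply/eqP; apply: (K v p2).
  by rewrite (K u v x1 x2) ?eqxx in x12.
suff Kx y1 y2 : adj u y1 || adj p1 y1 -> ~~ adj v y1 ->
                adj u y2 || adj p1 y2 -> ~~ adj v y2 -> y1 = y2.
  apply/card_le1_eqP=> y1 y2; rewrite !inE !negbK.
  by move=> /andP[? ?] /andP[? ?]; exact: Kx.
(* v cannot miss both a vertex of N(u) outside N(p1) and a vertex of N(p1)
   outside N(u): the first one is x1, so N(p2) contains both. *)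
have split_case z1 z2 : adj u z1 -> ~~ adj u z2 -> ~~ adj p1 z1 -> adj p1 z2 ->
    ~~ adj v z1 -> ~~ adj v z2 -> z1 = z2.
  move=> uz1 uz2 pz1 pz2 vz1 vz2.
  have z1x1 : z1 = x1 by apply: (K u p1).
  have p2z2 : adj p2 z2.
    by rewrite -p12 //; apply: contraNneq uz2 => ->.
  by apply: (K p2 v); rewrite // z1x1.
move=> up1 vy1 up2 vy2.
have [uy1|uy1] := boolP (adj u y1); have [uy2|uy2] := boolP (adj u y2).
- exact: (K u v).
- have [py1|py1] := boolP (adj p1 y1); rewrite (negPf uy2) /= in up2.
    exact: (K p1 v).
  exact: split_case.
- have [py2|py2] := boolP (adj p1 y2); rewrite (negPf uy1) /= in up1.
    exact: (K p1 v).
  by apply/esym; apply: split_case.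
- by rewrite (negPf uy1) in up1; rewrite (negPf uy2) in up2; exact: (K p1 v).
Qed.

(** * The lower bound *)

(** Double counting of the edges that meet [S]: outside the core every top
vertex has at most one neighbour, so each top vertex is counted at most once. *)
Lemma sum_card_conbr_leq (G : bigraph) (C S : {set bot G}) :
  star_like C -> [disjoint S & C] ->
  \sum_(y in S) #|conbr y| <= #|\bigcup_(y in S) conbr y|.
Proof.
move=> starC SC.
have -> : \sum_(y in S) #|conbr y| = \sum_(u : top G) #|nbr u :&: S|.
  transitivity (\sum_(y in S) \sum_(u : top G) (adj u y : nat)).
    by apply: eq_bigr => y _; rewrite -sum1dep_card big_mkcond.
  rewrite exchange_big; apply: eq_bigr => u _.
  rewrite -sum1_card big_mkcond [RHS]big_mkcond.
  by apply: eq_bigr => y _; rewrite !inE; case: (adj u y); case: (y \in S).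
rewrite -sum1_card [leqRHS]big_mkcond; apply: leq_sum => u _.
have [-> | [y]] := set_0Vmem (nbr u :&: S); first by rewrite cards0.
rewrite !inE => /andP[uy yS].
have -> : u \in \bigcup_(y in S) conbr y.
  by apply/bigcupP; exists y; rewrite ?inE.
apply: leq_trans (proj2 (starC u)); apply: subset_leq_card.
rewrite setDE; apply: setIS; rewrite -disjoints_subset.
exact: SC.
Qed.

Lemma star_like_leq_bi_h (G : bigraph) (C : {set bot G}) (n k : nat) :
  #|top G| = n -> #|bot G| = n -> star_like C -> 5 * k <= 2 * n -> k <= bi_h G.
Proof.
move=> topn botn starC kn; rewrite leq_max.
have [kC | Ck] := leqP k #|C|; apply/orP; [right | left].
  apply: (complete_pair_leq_omega (A := setT) _ kC).
    by rewrite cardsT; lia.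
  by move=> a b _ bC; have := subsetP (proj1 (starC a)) b bC; rewrite inE.
have cardR : #|C| + #|~: C| = n by rewrite cardsC.
pose L := [set y in ~: C | #|conbr y| <= 1].
have [kL | Lk] := leqP k #|L|.
  (* The k light vertices in B meet at most k <= n - k top vertices. *)
  have [B /subsetP BL kB] := subset_of_card kL.
  apply: (empty_pair_leq_alpha (A := ~: \bigcup_(y in B) conbr y) (B := B)).
  - have := cardsC (\bigcup_(y in B) conbr y).
    have : #|\bigcup_(y in B) conbr y| <= 1 * #|B|.
      by apply: card_bigcup_leq => y /BL; rewrite inE => /andP[].
    by rewrite topn kB; lia.
  - by rewrite kB.
  - move=> a b aB bB; apply: contraNN (_ : a \notin \bigcup_(y in B) conbr y).
      by move=> ab; apply/bigcupP; exists b; rewrite ?inE.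
    by move: aB; rewrite inE.
have LR : L \subset ~: C by apply/subsetP=> y; rewrite inE => /andP[].
(* Fewer than k vertices outside C are light, so leaving out k of them can
   remove every light one; the top vertices that meet the remaining set S
   have no neighbour among the k vertices left out. *)
have [S SRL cardS] : exists2 S : {set bot G},
    S \subset ~: C :\: L & #|S| = #|~: C| - k.
  by apply: subset_of_card; rewrite cardsDS //; lia.
have SR : S \subset ~: C := subset_trans SRL (subsetDl _ _).
apply: (empty_pair_leq_alpha (A := \bigcup_(y in S) conbr y) (B := ~: C :\: S)).
- have SC : [disjoint S & C] by rewrite disjoints_subset.
  apply: leq_trans (sum_card_conbr_leq starC SC).
  suff : \sum_(y in S) 2 <= \sum_(y in S) #|conbr y|.
    by rewrite sum_nat_const cardS; lia.
  apply: leq_sum => y yS; have := subsetP SRL y yS.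
  by rewrite !inE => /andP[+ yC]; rewrite yC -ltnNge.
- by rewrite cardsDS // cardS; lia.
- move=> a b /bigcupP[y yS]; rewrite !inE => ay /andP[bS bC].
  apply: contraNN bS => ab.
  have yC := subsetP SR y yS; rewrite inE in yC.
  suff -> : b = y by [].
  by apply: (card_le1_eq (proj2 (starC a))); rewrite !inE ?yC ?bC.
Qed.

(** * The extremal graph and tightness *)

Definition extremal (m : nat) : bigraph :=
  @Bigraph 'I_(5 * m) 'I_(5 * m)
    (fun u y => (y < 2 * m) || (y == 2 * m + u./2 :> nat)).

Definition extremal_core (m : nat) : {set bot (extremal m)} :=
  [set y : 'I_(5 * m) | y < 2 * m].

Lemma in_extremal_core (m : nat) (y : 'I_(5 * m)) :
  (y \in extremal_core m) = (y < 2 * m).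
Proof. by rewrite [LHS]inE. Qed.

Lemma card_extremal_core (m : nat) : #|extremal_core m| = 2 * m.
Proof.
have le25 : 2 * m <= 5 * m by lia.
by rewrite -sum1dep_card (big_ord_narrow le25) sum1_card card_ord.
Qed.

Lemma extremal_bifree (m : nat) : bifree H4 (extremal m).
Proof.
apply/bifree_H4P=> u v; apply/card_le1_eqP=> y z.
rewrite !inE /= !negb_or.
move=> /andP[/andP[/negPf-> _] /eqP yu] /andP[/andP[/negPf-> _] /eqP zu].
by apply/val_inj; rewrite /= yu zu.
Qed.

Lemma card_conbr_extremal (m : nat) (y : bot (extremal m)) :
  y \notin extremal_core m -> #|conbr y| <= 2.
Proof.
rewrite in_extremal_core => /negPf yhigh; rewrite cardE -(size_map val).
pose c := y - 2 * m; apply: (@uniq_leq_size _ _ [:: c.*2; c.*2.+1]).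
  by rewrite (map_inj_uniq val_inj) enum_uniq.
move=> _ /mapP[u + ->]; rewrite mem_enum !inE /= yhigh /= => /eqP yu.
by rewrite /c yu addKn; lia.
Qed.

Lemma bi_omega_extremal (m : nat) : 0 < m -> bi_omega (extremal m) <= 2 * m.
Proof.
move=> m0; apply/bigmax_leqP=> -[A B] /= /andP[/eqP cardAB /forall_inP AB].
have [Bcore | /subsetPn[b bB bcore]] := boolP (B \subset extremal_core m).
  by rewrite cardAB -card_extremal_core subset_leq_card.
suff A2 : #|A| <= 2 by apply: leq_trans A2 _; lia.
apply: leq_trans (card_conbr_extremal bcore); apply: subset_leq_card.
by apply/subsetP=> a aA; rewrite inE; apply: (forall_inP (AB a aA)).
Qed.

Lemma bi_alpha_extremal (m : nat) : bi_alpha (extremal m) <= 2 * m.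
Proof.
apply/bigmax_leqP=> -[A B] /= /andP[/eqP cardAB /forall_inP AB].
have {}AB a b : a \in A -> b \in B -> ~~ adj a b.
  by move=> aA; apply: (forall_inP (AB a aA)).
have [-> | [a0 a0A]] := set_0Vmem A; first by rewrite cards0.
have Bcore : B \subset ~: extremal_core m.
  apply/subsetP=> b bB; rewrite inE in_extremal_core.
  by apply: contraNN (AB a0 b a0A bB) => blow; rewrite /= blow.
(* Every a in A has its neighbour outside the core in S, which accounts for at
   most 2 * (3m - t) vertices of A, where t = #|A| = #|B|. *)
pose S := ~: extremal_core m :\: B.
have cardS : #|S| = 3 * m - #|B|.
  have := cardsC (extremal_core m).
  by rewrite /S cardsDS // card_extremal_core card_ord; lia.
have AS : A \subset \bigcup_(y in S) conbr y.
  apply/subsetP=> a aA.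
  have y_lt : 2 * m + a./2 < 5 * m by have := ltn_ord a; lia.
  have ay : @adj (extremal m) a (Ordinal y_lt) by rewrite /= eqxx orbT.
  apply/bigcupP; exists (Ordinal y_lt); last by rewrite inE.
  rewrite 2!inE in_extremal_core /= -leqNgt leq_addr andbT; apply/negP=> yB.
  by have := AB a _ aA yB; rewrite ay.
have A_le : #|A| <= 2 * #|S|.
  apply: leq_trans (subset_leq_card AS) _.
  apply: card_bigcup_leq => y; rewrite 2!inE => /andP[_].
  exact: card_conbr_extremal.
by move: A_le; rewrite cardS -cardAB; move: #|A| => a; lia.
Qed.

Theorem lemma7 (n : nat) (hn : 0 < n) :
  (forall G : bigraph,
     #|top G| = n -> #|bot G| = n -> bifree H4 G -> (2 * n) %/ 5 <= bi_h G) /\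
  (5 %| n ->
   exists G : bigraph,
     [/\ #|top G| = n, #|bot G| = n, bifree H4 G & bi_h G = (2 * n) %/ 5]).
Proof.
have lower (G : bigraph) : #|top G| = n -> #|bot G| = n -> bifree H4 G ->
    (2 * n) %/ 5 <= bi_h G.
  move=> topn botn /bifree_H4P nbrG.
  have k_le : 5 * (2 * n %/ 5) <= 2 * n by rewrite mulnC leq_divM.
  have [[C starC] | [C starC]] := star_like_or_co nbrG.
    exact: (star_like_leq_bi_h topn botn starC).
  rewrite -bi_h_bicompl.
  exact: (@star_like_leq_bi_h (bicompl G) C n).
split=> // /dvdnP[m nm].
have m0 : 0 < m by lia.
have n5 : n = 5 * m by rewrite nm mulnC.
have cardn : #|'I_(5 * m)| = n by rewrite card_ord.
exists (extremal m); split=> //; first exact: extremal_bifree.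
apply/eqP; rewrite eqn_leq lower ?andbT //; last exact: extremal_bifree.
rewrite geq_max.
have -> : 2 * n %/ 5 = 2 * m by rewrite n5 mulnCA mulKn.
by rewrite bi_alpha_extremal bi_omega_extremal.
Qed.
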